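(* Let $U\subset\mathbb R^m$ be a nonempty closed convex set, $B\in\mathbb R^{m\times m}$ symmetric positive semidefinite, $R\in\mathbb R^{m\times n}$ injective, $b\in\mathbb R^m$, and let $g:=\theta_{(U,B,R,b)}$ be the associated extended piecewise linear-quadratic function on $\mathbb R^n$. Let $\mu>0$. If $B$ is positive definite or $U$ is bounded, then $$e_\mu\,\theta_{(U,B,R,b)}=\theta_{(U,\hat B,R,b)},\qquad\text{where }\hat B=B+\mu RR^T.$$ Moreover, for each $x\in\mathbb R^n$ there exists a saddle-point $(\bar u,\bar v)\in U\times\mathbb R^n$ for the closed proper concave-convex saddle-function $$K(u,v):=\langle Rv-b,u\rangle-\tfrac12u^TBu+\tfrac1{2\mu}\|x-v\|^2-\delta(u\mid U)$$ satisfying $e_\mu g(x)=K(\bar u,\bar v)$.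
   Context: $\theta_{(U,B,R,b)}(x):=\sup_{u\in U}\{\langle u,Rx-b\rangle-\frac12u^TBu\}$ for $x\in\mathbb R^n$. For $\mu>0$, the Moreau envelope of $g:\mathbb R^n\to\mathbb R\cup\{+\infty\}$ is $e_\mu g(x):=\inf_{w\in\mathbb R^n}\{g(w)+\frac1{2\mu}\|w-x\|^2\}$ (Euclidean norm). $\delta(u\mid U)=0$ if $u\in U$ and $+\infty$ otherwise. $K$ is considered as a function of $(u,v)\in\mathbb R^m\times\mathbb R^n$ for fixed $x$ (concave in $u$, convex in $v$); a saddle-point is a pair $(\bar u,\bar v)$ with $K(u,\bar v)\le K(\bar u,\bar v)\le K(\bar u,v)$ for all $u\in\mathbb R^m$, $v\in\mathbb R^n$. *)

(* Defs.v *)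
From HB Require Import structures.
From mathcomp Require Import all_boot all_order all_algebra.
From mathcomp Require Import all_classical all_reals all_analysis.

Set Implicit Arguments.
Unset Strict Implicit.
Unset Printing Implicit Defensive.

Import Order.TTheory GRing.Theory Num.Theory.
Import numFieldNormedType.Exports.

Local Open Scope classical_set_scope.
Local Open Scope ring_scope.

(* R^n is 'cV[R]_n. The norm `|x| that MathComp-Analysis puts on matrices is
   the max-norm; it has the right closed and bounded sets, but the Moreau
   envelope needs the Euclidean norm, hence [enorm]. *)

Definition dotcv (R : realType) (n : nat) (x y : 'cV[R]_n) : R :=
  (x^T *m y) 0 0.

Definition enorm (R : realType) (n : nat) (x : 'cV[R]_n) : R :=
  Num.sqrt (dotcv x x).

Definition sym_psd (R : realType) (m : nat) (B : 'M[R]_m) : Prop :=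
  B^T = B /\ forall u : 'cV[R]_m, 0 <= dotcv u (B *m u).

Definition sym_pd (R : realType) (m : nat) (B : 'M[R]_m) : Prop :=
  B^T = B /\ forall u : 'cV[R]_m, u != 0 -> 0 < dotcv u (B *m u).

Definition indic_cvx (R : realType) (T : Type) (U : set T) (u : T) : \bar R :=
  if `[< U u >] then 0%E else +oo%E.

Definition theta (R : realType) (m n : nat) (U : set 'cV[R]_m) (B : 'M[R]_m)
    (A : 'M[R]_(m, n)) (b : 'cV[R]_m) (x : 'cV[R]_n) : \bar R :=
  ereal_sup [set (dotcv u (A *m x - b) - 2^-1 * dotcv u (B *m u))%:E | u in U].

Definition moreau_env (R : realType) (n : nat) (mu : R)
    (g : 'cV[R]_n -> \bar R) (x : 'cV[R]_n) : \bar R :=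
  ereal_inf [set (g w + ((2 * mu)^-1 * enorm (w - x) ^+ 2)%:E)%E
            | w in [set: 'cV[R]_n]].

(* Convexity of an extended-real-valued function is convexity of its epigraph,
   which avoids +oo - oo. *)
Definition econvex (R : realType) (n : nat) (f : 'cV[R]_n -> \bar R) : Prop :=
  convex_set [set p : 'cV[R]_n * R^o | (f p.1 <= (p.2 : R)%:E)%E].

Definition econcave (R : realType) (n : nat) (f : 'cV[R]_n -> \bar R) : Prop :=
  econvex (fun x => - f x)%E.

(* Closure operation of Rockafellar, Convex Analysis, Section 7: the lower
   semicontinuous hull of f if f > -oo everywhere, the constant -oo otherwise.
   [nbhs x] is not punctured, so the limit inferior takes f x into account. *)
Definition cvx_closure (R : realType) (n : nat) (f : 'cV[R]_n -> \bar R)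
    (x : 'cV[R]_n) : \bar R :=
  if `[< exists y, f y = -oo%E >] then -oo%E else limf_einf f (nbhs x).

Definition ccv_closure (R : realType) (n : nat) (f : 'cV[R]_n -> \bar R)
    (x : 'cV[R]_n) : \bar R :=
  (- cvx_closure (fun y => - f y) x)%E.

(* Concave-convex saddle-functions on R^m x R^n, following Rockafellar, Convex
   Analysis, Sections 33-34. *)
Section SaddleFunctions.
Variables (R : realType) (m n : nat).
Implicit Types K L : 'cV[R]_m -> 'cV[R]_n -> \bar R.

Definition concave_convex K : Prop :=
  (forall v, econcave (fun u => K u v)) /\ (forall u, econvex (K u)).

Definition cl1 K : 'cV[R]_m -> 'cV[R]_n -> \bar R :=
  fun u v => ccv_closure (fun u' => K u' v) u.

Definition cl2 K : 'cV[R]_m -> 'cV[R]_n -> \bar R :=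
  fun u v => cvx_closure (K u) v.

Definition saddle_equiv K L : Prop := cl1 K = cl1 L /\ cl2 K = cl2 L.

Definition saddle_closed K : Prop :=
  saddle_equiv (cl1 K) K /\ saddle_equiv (cl2 K) K.

Definition saddle_proper K : Prop :=
  (exists u, forall v, (-oo < K u v)%E) /\
  (exists v, forall u, (K u v < +oo)%E).

Definition saddle_point K (ubar : 'cV[R]_m) (vbar : 'cV[R]_n) : Prop :=
  forall u v, (K u vbar <= K ubar vbar)%E /\ (K ubar vbar <= K ubar v)%E.

End SaddleFunctions.

Definition envK (R : realType) (m n : nat) (U : set 'cV[R]_m) (B : 'M[R]_m)
    (A : 'M[R]_(m, n)) (b : 'cV[R]_m) (mu : R) (x : 'cV[R]_n)
    (u : 'cV[R]_m) (v : 'cV[R]_n) : \bar R :=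
  ((dotcv (A *m v - b) u - 2^-1 * dotcv u (B *m u)
    + (2 * mu)^-1 * enorm (x - v) ^+ 2)%:E - indic_cvx R U u)%E.

(* Main.v *)
Require Import Defs.
From HB Require Import structures.
From mathcomp Require Import all_boot all_order all_algebra.
From mathcomp Require Import all_classical all_reals all_analysis.
From mathcomp Require Import ring lra.

(** Minimizing K(u, .) over v is an unconstrained strongly convex quadratic
problem, solved by v = x - mu *: (A^T *m u); the value is
<u, A x - b> - 1/2 <u, (B + mu A A^T) u>, the function whose supremum over
U is theta U (B + mu A A^T) A b x. The proposition says that this sup-inf
equals the inf-sup defining the Moreau envelope, and the equality is obtained
by exhibiting a saddle-point rather than by a minimax theorem.

Take ubar maximizing the concave quadratic above over U. It exists by
compactness: if B is positive definite then so is B + mu A A^T and the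
quadratic is coercive, and otherwise U itself is compact ([quad_attains_min]). Put
vbar = x - mu *: (A^T *m ubar). In v, K(ubar, .) has zero gradient at vbar.
In u, the gradient A vbar - b - B ubar of K(., vbar) at ubar equals
A x - b - (B + mu A A^T) ubar, which is the gradient at ubar of the function
that ubar maximizes; so the variational inequality for one problem is the
variational inequality for the other, and by concavity it suffices for
optimality ([saddle_point_envK]). A saddle-point forces the envelope to take
the saddle value ([moreau_env_saddle]), and that value is
theta U (B + mu A A^T) A b x ([envK_diag], [theta_quad]).

For the regularity of K, both K(., v) up to sign and K(u, .) for u in U are a
finite convex quadratic plus the indicator of a closed convex set; such a
function is convex and lower semicontinuous, hence fixed by the closure
operation. For u outside U, K(u, .) is identically -oo, also fixed by it.
Therefore cl1 K = K and cl2 K = K. *)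

Set Implicit Arguments.
Unset Strict Implicit.
Unset Printing Implicit Defensive.

Import Order.TTheory GRing.Theory Num.Theory.
Import numFieldNormedType.Exports.

Local Open Scope classical_set_scope.
Local Open Scope ring_scope.

(** * Euclidean inner product, continuity and compactness *)

Section Dot.
Variables (R : realType).
Implicit Types (m n : nat).

Lemma dotcvE n (x y : 'cV[R]_n) : dotcv x y = \sum_i x i 0 * y i 0.
Proof. by rewrite /dotcv mxE; apply: eq_bigr => i _; rewrite mxE. Qed.

Lemma dotcvC n (x y : 'cV[R]_n) : dotcv x y = dotcv y x.
Proof. by rewrite !dotcvE; apply: eq_bigr => i _; rewrite mulrC. Qed.

Lemma dotcvDl n (x y z : 'cV[R]_n) : dotcv (x + y) z = dotcv x z + dotcv y z.
Proof. by rewrite /dotcv linearD mulmxDl mxE. Qed.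

Lemma dotcvZl n k (x z : 'cV[R]_n) : dotcv (k *: x) z = k * dotcv x z.
Proof. by rewrite /dotcv linearZ -scalemxAl mxE. Qed.

Lemma dotcvDr n (x y z : 'cV[R]_n) : dotcv z (x + y) = dotcv z x + dotcv z y.
Proof. by rewrite dotcvC dotcvDl !(dotcvC z). Qed.

Lemma dotcvZr n k (x z : 'cV[R]_n) : dotcv z (k *: x) = k * dotcv z x.
Proof. by rewrite dotcvC dotcvZl (dotcvC z). Qed.

Lemma dotcvNl n (x z : 'cV[R]_n) : dotcv (- x) z = - dotcv x z.
Proof. by rewrite -scaleN1r dotcvZl mulN1r. Qed.

Lemma dotcvNr n (x z : 'cV[R]_n) : dotcv z (- x) = - dotcv z x.
Proof. by rewrite dotcvC dotcvNl (dotcvC z). Qed.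

Definition dotcv_lin :=
  (dotcvDl, dotcvDr, dotcvNl, dotcvNr, dotcvZl, dotcvZr).

Lemma dotcv_trmx m n (u : 'cV[R]_m) (M : 'M[R]_(m, n)) (v : 'cV[R]_n) :
  dotcv u (M *m v) = dotcv (M^T *m u) v.
Proof. by rewrite /dotcv trmx_mul trmxK mulmxA. Qed.

Lemma dotcv_ge0 n (x : 'cV[R]_n) : 0 <= dotcv x x.
Proof. by rewrite dotcvE; apply: sumr_ge0 => i _; rewrite -expr2 sqr_ge0. Qed.

Lemma enorm_sqr n (x : 'cV[R]_n) : enorm x ^+ 2 = dotcv x x.
Proof. by rewrite /enorm sqr_sqrtr// dotcv_ge0. Qed.

Lemma continuous_dotcv (T : topologicalType) n (f g : T -> 'cV[R]_n) :
  continuous f -> continuous g -> continuous (fun t => dotcv (f t) (g t)).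
Proof.
move=> cf cg.
have -> : (fun t => dotcv (f t) (g t)) =
          fun t => \sum_(i <- enum 'I_n) f t i 0 * g t i 0.
  by apply/funext => s; rewrite dotcvE big_enum.
move=> t; rewrite /continuous_at.
elim: (enum 'I_n) => [|i s IH].
  rewrite big_nil; under eq_fun do rewrite big_nil; exact: cvg_cst.
rewrite big_cons; under eq_fun do rewrite big_cons.
apply: cvgD IH; apply: cvgM.
- exact: (cvg_comp _ _ (cf t) (@coord_continuous _ _ _ i 0 (f t))).
- exact: (cvg_comp _ _ (cg t) (@coord_continuous _ _ _ i 0 (g t))).
Qed.

Lemma continuous_mulmx m n (M : 'M[R]_(m, n)) :
  continuous (fun u : 'cV[R]_n => M *m u).
Proof.
move=> u; have Fu : ProperFilter (nbhs u) by exact: nbhs_pfilter.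
apply/cvg_ballP => e e0.
suff : \forall w \near u, forall i, ball ((M *m u) i 0) e ((M *m w) i 0).
  by apply: filterS => w uw; split=> // i j; rewrite (ord1 j).
apply: (@filter_forall _ _
  (fun i w => ball ((M *m u) i 0) e ((M *m w) i 0)) (nbhs u)) => i.
have E x : (M *m x) i 0 = dotcv (row i M)^T x.
  by rewrite dotcvE mxE; apply: eq_bigr => k _; rewrite !mxE.
have cd : continuous (dotcv (row i M)^T).
  apply: continuous_dotcv; first exact: cst_continuous.
  by move=> x; exact: cvg_id.
have /cvg_ballP/(_ e e0) := cd u.
by apply: filterS => w; rewrite !E.
Qed.

Lemma continuous_trmx m n : continuous (@trmx R m n).
Proof.
move=> u; have Fu : ProperFilter (nbhs u) by exact: nbhs_pfilter.
apply/cvg_ballP => e e0; apply/(@nbhs_ballP R 'M[R]_(m, n)).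
exists e => //= w [_ uw].
by split => // i j; rewrite !mxE; exact: uw.
Qed.

Lemma trmx_norm m n (u : 'M[R]_(m, n)) : `|u^T| = `|u|.
Proof.
rewrite /Num.Def.normr /= !mx_normrE; apply/le_anti/andP; split;
  apply/bigmax_leP; split=> [|[i j] _]; rewrite ?mxE /=.
- by apply: bigmax_ge_id.
- exact: (le_bigmax _ (fun ij => `|u ij.1 ij.2|) (j, i)).
- by apply: bigmax_ge_id.
- have := (le_bigmax 0 (fun ij => `|u^T ij.1 ij.2|) (j, i)).
  by rewrite mxE.
Qed.

(** Transposition is an isometry onto row vectors, where Heine-Borel is known. *)
Lemma bounded_closed_compact_cV n (A : set 'cV[R]_n) :
  bounded_set A -> closed A -> compact A.
Proof.
move=> [M [Mreal bM]] cA.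
have -> : A = trmx @` (trmx @^-1` A : set 'rV[R]_n).
  apply/seteqP; split => [u Au|_ [u Au <-]//].
  by exists u^T; rewrite /= trmxK.
apply: continuous_compact.
  by apply: continuous_subspaceT => u; exact: continuous_trmx.
apply: bounded_closed_compact.
  by exists M; split=> // y My u /= /(bM _ My) /=; rewrite trmx_norm.
by apply: closed_comp cA => u _; exact: continuous_trmx.
Qed.

End Dot.

(** * Convex quadratic functions *)

Section Quad.
Local Open Scope convex_scope.
Variables (R : realType) (m : nat).
Implicit Types (C : 'M[R]_m) (a u w : 'cV[R]_m) (d : R) (U : set 'cV[R]_m).

Definition quad C a d u : R := 2^-1 * dotcv u (C *m u) + dotcv u a + d.

(** A quadratic function is its second order Taylor polynomial; the gradient
    at u is C *m u + a, by symmetry of C. *)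
Lemma quad_taylor C a d u w t : C^T = C ->
  quad C a d (u + t *: w) =
  quad C a d u + t * dotcv w (C *m u + a) + 2^-1 * t ^+ 2 * dotcv w (C *m w).
Proof.
move=> sC; rewrite /quad mulmxDr -scalemxAr !dotcv_lin.
rewrite (dotcv_trmx u C w) sC (dotcvC (C *m u) w); by field.
Qed.

Lemma continuous_quad C a d : continuous (quad C a d).
Proof.
have cid : continuous (fun u : 'cV[R]_m => u) by move=> x; exact: cvg_id.
move=> u; have Fu : ProperFilter (nbhs u) by exact: nbhs_pfilter.
apply: cvgD; last exact: cst_continuous.
apply: cvgD; last exact: (continuous_dotcv cid (@cst_continuous _ _ _)).
apply: cvgM; first exact: cst_continuous.
exact: (continuous_dotcv cid (@continuous_mulmx _ _ _ _)).
Qed.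

Lemma quad_ge_tangent C a d u w : sym_psd C ->
  quad C a d u + dotcv (w - u) (C *m u + a) <= quad C a d w.
Proof.
move=> [sC pC]; have := quad_taylor a d u (w - u) 1 sC.
rewrite scale1r addrC subrK => ->.
have := pC (w - u); lra.
Qed.

(** Averaging the tangent inequalities at the point z = x <| t |> y makes the
    two linear terms cancel. *)
Lemma convex_quad C a d : sym_psd C ->
  convex_function [set: 'cV[R]_m] (quad C a d).
Proof.
move=> psdC t x y _ _.
rewrite convRE; set z := x <| t |> y.
have zE : z = t%:num *: x + (1 - t%:num) *: y by [].
have := quad_ge_tangent a d z x psdC; have := quad_ge_tangent a d z y psdC.
have t0 : 0 <= t%:num by exact: ge0.
have t1 : t%:num <= 1 by exact: le1.
rewrite /= /unstable.onem.
have -> : x - z = (1 - t%:num) *: (x - y).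
  by rewrite zE; apply/matrixP => i j; rewrite !mxE; ring.
have -> : y - z = - t%:num *: (x - y).
  by rewrite zE; apply/matrixP => i j; rewrite !mxE; ring.
rewrite !dotcvZl; move: {zE z} (dotcv _ _) (quad _ _ _ _) (quad _ _ _ _)
  (quad _ _ _ _) t%:num t0 t1.
move=> *; nra.
Qed.

(** Otherwise the slope p towards w would be negative, and a short step from u
    towards w would decrease the function. *)
Lemma quad_min_variational U C a d u w : sym_psd C -> convex_set U ->
  U u -> (forall u', U u' -> quad C a d u <= quad C a d u') -> U w ->
  0 <= dotcv (w - u) (C *m u + a).
Proof.
move=> [sC pC] cU Uu minu Uw; rewrite leNgt; apply/negP => p0.
set p := dotcv _ _ in p0; set q := dotcv (w - u) (C *m (w - u)).
have q0 : 0 <= q by exact: pC.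
(* A step t changes the value by t p + t^2 q / 2; any t in ]0, 1] with
   t q < - 2 p contradicts minimality, and t = - p / (q - p) is one. *)
have [t tE /andP[t0 t1]] : exists2 t, t * (q - p) = - p & 0 < t <= 1.
  have qp : 0 < q - p by rewrite subr_gt0 (lt_le_trans p0).
  exists (- p / (q - p)); first by rewrite mulfVK// gt_eqF.
  by rewrite divr_gt0 ?oppr_gt0// ler_pdivrMr// mul1r lerDr.
pose t' := Itv01 (ltW t0) t1.
have := cU w u t'; rewrite !inE => /(_ Uw Uu) /minu.
have -> : (w : convex_lmodType 'cV[R]_m) <| t' |>
          (u : convex_lmodType 'cV[R]_m) = u + t *: (w - u).
  transitivity (t *: w + (1 - t) *: u); first by [].
  by apply/matrixP => i j; rewrite !mxE; ring.
rewrite quad_taylor// -/p -/q.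
clear sC; nra.
Qed.

Lemma dotcv_bound a : exists2 M, 0 <= M & forall u, `|dotcv u a| <= M * `|u|.
Proof.
exists (\sum_i `|a i 0|); first exact: sumr_ge0.
move=> u; rewrite dotcvE (le_trans (ler_norm_sum _ _ _))// mulr_suml.
apply: ler_sum => i _; rewrite normrM mulrC ler_wpM2l//.
rewrite [leRHS]/Num.Def.normr /= mx_normrE.
exact: (le_bigmax _ (fun ij => `|u ij.1 ij.2|) (i, 0)).
Qed.

(** By homogeneity it is enough to take for c the minimum of the form over the
    unit sphere, which is compact. *)
Lemma sym_pd_coercive C : sym_pd C ->
  exists2 c, 0 < c & forall u, c * `|u| ^+ 2 <= dotcv u (C *m u).
Proof.
move=> [sC pC]; pose S := [set u : 'cV[R]_m | `|u| = 1].
(* The sphere is empty exactly in dimension 0, where any c will do. *)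
have [S0|/set0P/negP/negPn/eqP S0] := pselect (S !=set0); last first.
  exists 1 => // u; have [->|u0] := eqVneq u 0.
    by rewrite normr0 expr0n mulr0 dotcvE big1// => i _; rewrite mxE mul0r.
  exfalso; have : S (`|u|^-1 *: u).
    by rewrite /S /= normrZ normfV normr_id mulVf// normr_eq0.
  by rewrite S0.
have cS : compact S.
  apply: bounded_closed_compact_cV.
    exists 1; split => // y y1 u /= ->; exact: ltW.
  have -> : S = (fun u : 'cV[R]_m => `|u|) @^-1` [set 1 : R] by [].
  apply: closed_comp (@closed_eq _ _) => u _; exact: norm_continuous.
have cq : continuous (fun u => dotcv u (C *m u)).
  apply: continuous_dotcv; last exact: continuous_mulmx.
  by move=> x; exact: cvg_id.
have [c] := compact_EVT_min S0 cS (continuous_subspaceT cq).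
rewrite inE => Sc minc.
exists (dotcv c (C *m c)).
  by apply: pC; rewrite -normr_gt0 Sc.
move=> u; have [->|u0] := eqVneq u 0.
  by rewrite normr0 expr0n mulr0 dotcvE big1// => i _; rewrite mxE mul0r.
have /minc : `|u|^-1 *: u \in S.
  by rewrite inE /S /= normrZ normfV normr_id mulVf// normr_eq0.
rewrite -scalemxAr dotcvZl dotcvZr mulrA -expr2 exprVn mulrC ler_pdivlMr//.
by rewrite exprn_gt0// normr_gt0.
Qed.

(** The minimum over U is the minimum over the sublevel set of any point of U,
    which is bounded because U is, or because C is coercive. *)
Lemma quad_attains_min U C a d : U !=set0 -> closed U ->
  sym_pd C \/ bounded_set U ->
  exists2 u, U u & forall w, U w -> quad C a d u <= quad C a d w.
Proof.
move=> [u0 Uu0] cU pdb.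
pose V := U `&` [set u | quad C a d u <= quad C a d u0].
have cV : closed V.
  apply: closedI => //.
  apply: (@closed_comp _ _ (quad C a d) [set y | y <= quad C a d u0]).
    by move=> u _; exact: continuous_quad.
  exact: closed_le.
have bV : bounded_set V.
  case: pdb => [pdC|[M [Mr bM]]]; last first.
    by exists M; split=> // y yM u [Uu _]; exact: bM.
  have [c c0 coer] := sym_pd_coercive pdC.
  have [M M0 bM] := dotcv_bound a.
  set k := `|quad C a d u0 - d|.
  (* In the sublevel set, c r^2 / 2 <= M r + k with r the norm of u; for
     r >= 1 this gives c r / 2 <= M + k. *)
  exists (Num.max 1 (2 * (M + k) / c)); split; first exact: num_real.
  move=> y; rewrite gt_max => /andP[y1 yc] u [Uu]; rewrite /= => qu.
  rewrite leNgt; apply/negP => yu.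
  have {}yc : 2 * (M + k) < y * c by rewrite -ltr_pdivrMr.
  have h1 := coer u; have := bM u; rewrite ler_norml => /andP[h2 _].
  have h3 : quad C a d u0 - d <= k by exact: ler_norm.
  have h4 : 0 <= k by exact: normr_ge0.
  move: qu; rewrite {1}/quad => qu.
  have h5 : c * `|u| <= 2 * (M + k).
    have u0' : 0 < `|u| by lra.
    rewrite -(ler_pM2r u0') -mulrA -expr2 (le_trans h1)//.
    have : k <= k * `|u| by rewrite ler_peMr//; lra.
    nra.
  nra.
have V0 : V !=set0 by exists u0; split => //=.
have [u] := compact_EVT_min V0 (bounded_closed_compact_cV bV cV)
  (continuous_subspaceT (@continuous_quad C a d)).
rewrite inE => -[Uu qu] minu; exists u => // w Uw.
have [ww|] := leP (quad C a d w) (quad C a d u0).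
  by apply: minu; rewrite inE.
by move=> /ltW; exact: le_trans.
Qed.

Lemma sym_psd_scalar c : 0 <= c -> sym_psd (c%:M : 'M[R]_m).
Proof.
move=> c0; split; first by rewrite tr_scalar_mx.
by move=> u; rewrite mul_scalar_mx dotcvZr mulr_ge0// dotcv_ge0.
Qed.

End Quad.

(** * Convexity and closure of extended-real-valued functions *)

Section Extended.
Variables (R : realType) (n : nat).
Implicit Types (D : set 'cV[R]_n) (f : 'cV[R]_n -> R) (g : 'cV[R]_n -> \bar R).
Local Open Scope ereal_scope.

(** The neighbourhoods are not punctured, so the limit inferior at x never
    exceeds the value at x. *)
Lemma limf_einf_lsc g x : lower_semicontinuous g -> limf_einf g (nbhs x) = g x.
Proof.
move=> lg; rewrite limf_einfE; apply/le_anti/andP; split.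
  apply: ge_ereal_sup => _ [V Vx <-]; apply: ereal_inf_lbound.
  by exists x => //; exact: nbhs_singleton.
have key a : a%:E < g x ->
    a%:E <= ereal_sup [set ereal_inf (g @` V) | V in nbhs x].
  move=> /lg [V Vx aV]; apply: ereal_sup_ge; exists (ereal_inf (g @` V)).
    by exists V.
  by apply: le_ereal_inf_tmp => _ [y Vy <-]; exact/ltW/aV.
move: key; case: (g x) => [r||] key; last by rewrite leNye.
  by apply/lee_subgt0Pr => e e0; apply: key; rewrite lte_fin gtrBl.
by rewrite leye_eq; apply/eqP/eqyP => r _; apply: key; rewrite ltry.
Qed.

Lemma econvex_add_indic D f : convex_set D ->
  convex_function [set: 'cV[R]_n] f ->
  econvex (fun x => (f x)%:E + indic_cvx R D x).
Proof.
move=> cD cf [x r] [y s] t; rewrite !inE /= /indic_cvx.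
case: asboolP => Dx; last by rewrite addey// leye_eq.
case: asboolP => Dy; last by rewrite addey// leye_eq.
rewrite !adde0 !lee_fin => fx fy.
case: asboolP; last first.
  by case; have := cD x y t; rewrite !inE; apply.
move=> _; rewrite adde0 lee_fin.
apply: (le_trans (cf t _ _ _ _)); rewrite ?inE//.
apply: lerD; apply: ler_wpM2l => //.
by rewrite subr_ge0; exact: le1.
Qed.

Lemma lsc_add_indic D f : closed D -> continuous f ->
  lower_semicontinuous (fun x => (f x)%:E + indic_cvx R D x).
Proof.
move=> cD cf x a; rewrite /indic_cvx.
case: asboolP => Dx; last first.
  move=> _; exists (~` D).
    by apply: open_nbhs_nbhs; split => //; exact: closed_openC.
  by move=> y Dy; case: asboolP => // _; rewrite addey// ltry.
rewrite adde0 lte_fin => afx; exists [set y | (a < f y)%R].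
  by apply: (cf x [set y | (a < y)%R]); exact: lt_nbhsr.
move=> y /= afy; case: asboolP => _; first by rewrite adde0 lte_fin.
by rewrite addey// ltry.
Qed.

Lemma cvx_closure_lsc g : lower_semicontinuous g ->
  (forall x, g x != -oo) -> cvx_closure g = g.
Proof.
move=> lg gN; apply/funext => x; rewrite /cvx_closure.
case: asboolP => [[y /eqP]|_]; first by rewrite (negbTE (gN y)).
exact: limf_einf_lsc.
Qed.

Lemma cvx_closure_Noo : cvx_closure (fun _ : 'cV[R]_n => -oo : \bar R) = fun=> -oo.
Proof.
by apply/funext => x; rewrite /cvx_closure asboolT//; exists x.
Qed.

End Extended.

(** * The saddle-function of the Moreau envelope *)

Section EnvK.
Variables (R : realType) (m n : nat) (U : set 'cV[R]_m) (B : 'M[R]_m)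
  (A : 'M[R]_(m, n)) (b : 'cV[R]_m) (mu : R) (x : 'cV[R]_n).
Hypothesis mu_gt0 : 0 < mu.

Local Notation K := (envK U B A b mu x).
Local Notation Bhat := (B + mu *: (A *m A^T)).

Lemma envK_quadl u v : K u v =
  (- ((quad B (b - A *m v) (- ((2 * mu)^-1 * enorm (x - v) ^+ 2)) u)%:E
      + indic_cvx R U u))%E.
Proof.
rewrite /envK /indic_cvx; case: asboolP => Uu /=; last by rewrite !addeNy.
rewrite oppr0 !addr0; congr (_%:E); rewrite /quad !dotcv_lin.
by rewrite !(dotcvC u); ring.
Qed.

Lemma envK_quadr u v : U u -> K u v =
  (quad (mu^-1)%:M (A^T *m u - mu^-1 *: x)
    ((2 * mu)^-1 * dotcv x x - dotcv b u - 2^-1 * dotcv u (B *m u)) v)%:E.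
Proof.
move=> Uu; rewrite /envK /indic_cvx asboolT// sube0 enorm_sqr; congr (_%:E).
rewrite /quad mul_scalar_mx !dotcv_lin (dotcvC (A *m v) u) dotcv_trmx.
rewrite (dotcvC v x) (dotcvC v (_ *m _)).
by field; rewrite ?gt_eqF.
Qed.

(** The indicator of the whole space makes the lemmas on functions of the form
    real-valued plus indicator apply to both variables alike. *)
Lemma envK_quadr_indic u : U u -> K u = fun v =>
  ((quad (mu^-1)%:M (A^T *m u - mu^-1 *: x)
     ((2 * mu)^-1 * dotcv x x - dotcv b u - 2^-1 * dotcv u (B *m u)) v)%:E
   + indic_cvx R setT v)%E.
Proof.
by move=> Uu; apply/funext => v; rewrite envK_quadr// /indic_cvx asboolT// adde0.
Qed.

Lemma envK_Noo u : ~ U u -> K u = fun=> -oo%E.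
Proof.
by move=> Uu; apply/funext => v; rewrite /envK /indic_cvx asboolF// addeNy.
Qed.

Lemma dotcv_Bhat u : dotcv u (Bhat *m u) =
  dotcv u (B *m u) + mu * dotcv (A^T *m u) (A^T *m u).
Proof.
by rewrite mulmxDl -scalemxAl -mulmxA !dotcv_lin (dotcv_trmx u A).
Qed.

Lemma Bhat_sym : B^T = B -> Bhat^T = Bhat.
Proof. by move=> sB; rewrite linearD linearZ /= trmx_mul trmxK sB. Qed.

Lemma sym_psd_Bhat : sym_psd B -> sym_psd Bhat.
Proof.
move=> [sB pB]; split; first exact: Bhat_sym.
by move=> u; rewrite dotcv_Bhat addr_ge0// mulr_ge0 ?dotcv_ge0// ltW.
Qed.

Lemma sym_pd_Bhat : sym_pd B -> sym_pd Bhat.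
Proof.
move=> [sB pB]; split; first exact: Bhat_sym.
move=> u u0; rewrite dotcv_Bhat ltr_pwDl ?pB//.
by rewrite mulr_ge0 ?dotcv_ge0// ltW.
Qed.

Lemma concave_convex_envK : sym_psd B -> convex_set U -> concave_convex K.
Proof.
move=> psdB cU; split => [v|u].
  rewrite /econcave; under eq_fun do rewrite envK_quadl oppeK.
  by apply: econvex_add_indic => //; exact: convex_quad.
have [Uu|Uu] := pselect (U u); last first.
  rewrite envK_Noo//.
  by move=> p q t _ _; rewrite inE /= leNye.
rewrite envK_quadr_indic//; apply: econvex_add_indic.
  by move=> p q t _ _; rewrite inE.
by apply/convex_quad/sym_psd_scalar; rewrite invr_ge0 ltW.
Qed.

Lemma cl1_envK : closed U -> cl1 K = K.
Proof.
move=> cU; apply/funext => u; apply/funext => v.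
rewrite /cl1 /ccv_closure; under eq_fun do rewrite envK_quadl oppeK.
rewrite cvx_closure_lsc ?envK_quadl//.
  by apply: lsc_add_indic => //; exact: continuous_quad.
by move=> w; rewrite /indic_cvx; case: asboolP.
Qed.

Lemma cl2_envK : cl2 K = K.
Proof.
apply/funext => u; have [Uu|Uu] := pselect (U u); last first.
  by rewrite /cl2 envK_Noo// cvx_closure_Noo.
rewrite /cl2 envK_quadr_indic// cvx_closure_lsc//.
  apply: lsc_add_indic; [exact: closedT|exact: continuous_quad].
by move=> v; rewrite /indic_cvx asboolT.
Qed.

Lemma saddle_closed_envK : closed U -> saddle_closed K.
Proof.
by move=> cU; rewrite /saddle_closed cl1_envK// cl2_envK; split; split.
Qed.

Lemma saddle_proper_envK : U !=set0 -> saddle_proper K.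
Proof.
move=> [u Uu]; split; first by exists u => v; rewrite envK_quadr// ltNyr.
by exists 0 => w; rewrite envK_quadl /indic_cvx; case: asboolP => _ //=;
  rewrite ltry.
Qed.

(** Both K(., vbar) and K(ubar, .) are quadratic, so optimality is read off
    from gradients: that of K(ubar, .) vanishes at vbar, and that of
    K(., vbar) at ubar satisfies the variational inequality of the problem
    which ubar solves. *)
Lemma saddle_point_envK ubar : sym_psd B -> convex_set U -> U ubar ->
  (forall u, U u ->
     quad Bhat (b - A *m x) 0 ubar <= quad Bhat (b - A *m x) 0 u) ->
  saddle_point K ubar (x - mu *: (A^T *m ubar)).
Proof.
move=> psdB cU Uubar minu u v; set vbar := x - _; split; last first.
  have grad0 : mu^-1%:M *m vbar + (A^T *m ubar - mu^-1 *: x) = 0.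
    rewrite mul_scalar_mx /vbar scalerBr scalerA mulVf ?gt_eqF// scale1r.
    by rewrite addrC subrKA subrr.
  have psdI : sym_psd (mu^-1%:M : 'M[R]_n).
    by apply: sym_psd_scalar; rewrite invr_ge0 ltW.
  rewrite !envK_quadr// lee_fin.
  apply: le_trans (quad_ge_tangent _ _ vbar v psdI).
  by rewrite grad0 lerDl /dotcv mulmx0 mxE.
have [Uu|Uu] := pselect (U u); last by rewrite envK_Noo// leNye.
rewrite !envK_quadl leeN2 /indic_cvx !asboolT// !adde0 lee_fin.
apply: le_trans (quad_ge_tangent _ _ ubar u psdB); rewrite lerDl.
(* Moving from x to vbar trades B for B + mu A A^T in the gradient. *)
have -> : B *m ubar + (b - A *m vbar) = Bhat *m ubar + (b - A *m x).
  rewrite /vbar mulmxBr -scalemxAr mulmxDl -scalemxAl -mulmxA.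
  by rewrite opprB -addrA; congr (_ + _); rewrite addrCA.
exact: quad_min_variational (sym_psd_Bhat psdB) cU Uubar minu Uu.
Qed.

(** The infimum over v of K(u, v), attained at v = x - mu *: (A^T *m u). *)
Lemma envK_diag u : U u ->
  K u (x - mu *: (A^T *m u)) = (- quad Bhat (b - A *m x) 0 u)%:E.
Proof.
move=> Uu; rewrite envK_quadl /indic_cvx asboolT// adde0 -EFinN; congr (- _)%:E.
rewrite /quad dotcv_Bhat enorm_sqr opprB addrCA subrr addr0.
rewrite mulmxBr -scalemxAr.
rewrite !dotcv_lin (dotcv_trmx u A (A^T *m u)).
by field; rewrite ?gt_eqF.
Qed.

Lemma theta_quad (C : 'M[R]_m) ubar : U ubar ->
  (forall u, U u -> quad C (b - A *m x) 0 ubar <= quad C (b - A *m x) 0 u) ->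
  theta U C A b x = (- quad C (b - A *m x) 0 ubar)%:E.
Proof.
have E u : dotcv u (A *m x - b) - 2^-1 * dotcv u (C *m u) =
    - quad C (b - A *m x) 0 u.
  by rewrite /quad -(opprB b) dotcvNr; ring.
move=> Uubar minu; apply/le_anti/andP; split.
  by apply: ge_ereal_sup => _ [u Uu <-]; rewrite E lee_fin lerN2 minu.
by apply: ereal_sup_ubound; exists ubar => //; rewrite E.
Qed.

(** For each v, theta plus the quadratic penalty is the supremum over U of
    K(., v), so the envelope is an inf-sup: evaluating it at vbar bounds it
    above, and bounding each supremum below by its term at ubar bounds it
    below. *)
Lemma moreau_env_saddle ubar vbar : U ubar -> saddle_point K ubar vbar ->
  moreau_env mu (theta U B A b) x = K ubar vbar.
Proof.
move=> Uubar sp.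
have KE u v : U u -> K u v = ((dotcv u (A *m v - b) -
    2^-1 * dotcv u (B *m u))%:E + ((2 * mu)^-1 * enorm (v - x) ^+ 2)%:E)%E.
  move=> Uu; rewrite /envK /indic_cvx asboolT// sube0 -EFinD dotcvC.
  by rewrite !enorm_sqr -(opprB v x) dotcvNl dotcvNr opprK.
apply/le_anti/andP; split.
  apply: (@le_trans _ _ (theta U B A b vbar +
     ((2 * mu)^-1 * enorm (vbar - x) ^+ 2)%:E)%E).
    by apply: ereal_inf_lbound; exists vbar.
  rewrite -leeBrDr//; apply: ge_ereal_sup => _ [u Uu <-].
  by rewrite leeBrDr// -KE//; have [] := sp u vbar.
apply: le_ereal_inf_tmp => _ [v _ <-].
apply: (@le_trans _ _ (K ubar v)); first by have [] := sp ubar v.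
by rewrite KE// leeD2r//; apply: ereal_sup_ubound; exists ubar.
Qed.

End EnvK.

Theorem proposition4p11 (R : realType) (m n : nat) (U : set 'cV[R]_m)
    (B : 'M[R]_m) (A : 'M[R]_(m, n)) (b : 'cV[R]_m) (mu : R)
    (U_nonempty : U !=set0) (U_closed : closed U) (U_convex : convex_set U)
    (B_psd : sym_psd B)
    (A_inj : injective (fun v : 'cV[R]_n => A *m v))
    (mu_gt0 : 0 < mu)
    (B_pd_or_U_bounded : sym_pd B \/ bounded_set U) :
  moreau_env mu (theta U B A b) = theta U (B + mu *: (A *m A^T)) A b
  /\
  forall x : 'cV[R]_n,
    [/\ concave_convex (envK U B A b mu x),
        saddle_closed (envK U B A b mu x),
        saddle_proper (envK U B A b mu x) &
        exists (ubar : 'cV[R]_m) (vbar : 'cV[R]_n),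
          [/\ U ubar,
              saddle_point (envK U B A b mu x) ubar vbar &
              moreau_env mu (theta U B A b) x = envK U B A b mu x ubar vbar]].
Proof.
set Bhat := B + _.
have attained x : exists2 u, U u & forall w, U w ->
    quad Bhat (b - A *m x) 0 u <= quad Bhat (b - A *m x) 0 w.
  apply: quad_attains_min => //.
  by case: B_pd_or_U_bounded => [/(sym_pd_Bhat A mu_gt0)|]; [left|right].
split.
  apply/funext => x; have [u Uu minu] := attained x.
  rewrite (theta_quad Uu minu) -(envK_diag B A b x mu_gt0 Uu).
  apply: moreau_env_saddle => //.
  exact: saddle_point_envK.
move=> x; have [u Uu minu] := attained x; split.
- exact: concave_convex_envK.
- exact: saddle_closed_envK.
- exact: saddle_proper_envK.
have sp : saddle_point (envK U B A b mu x) u (x - mu *: (A^T *m u)).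
  exact: saddle_point_envK.
exists u, (x - mu *: (A^T *m u)); split=> //.
exact: moreau_env_saddle.
Qed.
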